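(* For each integer $r$ and each non-negative integer $n$, \[ \sum_{k = 0}^n \binom {2k}{k} \binom {2(n - k)}{n-k} F_{4k+r} = F_{2n+r} \sum_{k = 0}^n \binom {n}{k}^2 5^k, \qquad \sum_{k = 0}^n \binom {2k}{k} \binom {2(n - k)}{n-k} L_{4k+r} = L_{2n+r} \sum_{k = 0}^n \binom {n}{k}^2 5^k. \]
   Context: $F_j$ and $L_j$ denote the Fibonacci and Lucas numbers: $F_0=0,F_1=1$, $L_0=2,L_1=1$, both satisfying $X_j=X_{j-1}+X_{j-2}$, extended to all integer indices via the recurrence (so $F_{-j}=(-1)^{j+1}F_j$, $L_{-j}=(-1)^jL_j$). *)

(* Defs.v *)
From mathcomp Require Import all_boot all_order all_algebra.
From mathcomp Require Import ring zify.
Set Implicit Arguments.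
Unset Strict Implicit.
Unset Printing Implicit Defensive.
Import GRing.Theory.
Local Open Scope ring_scope.

(* Acting on the pair (X_j, X_{j+1}) of consecutive terms. *)
Definition fib_next (p : int * int) : int * int := (p.2, p.1 + p.2).
Definition fib_prev (p : int * int) : int * int := (p.2 - p.1, p.1).

(* The bilateral sequence with X_0 = a, X_1 = b, X_j = X_{j-1} + X_{j-2}.
   Recall that [Negz m] is the integer -(m+1). *)
Definition fib_seq (a b j : int) : int :=
  match j with
  | Posz m => (iter m fib_next (a, b)).1
  | Negz m => (iter m.+1 fib_prev (a, b)).1
  end.

Definition fib (j : int) : int := fib_seq 0 1 j.
Definition lucas (j : int) : int := fib_seq 2 1 j.

Lemma fib_seq_rec (a b j : int) :
  fib_seq a b j = fib_seq a b (j - 1) + fib_seq a b (j - 2).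
Proof.
case: j => [[|[|m]]|m].
- by rewrite /= subrKC.
- by rewrite /= subrKC.
- have -> : m.+2%:Z - 1 = m.+1%:Z by lia.
  have -> : m.+2%:Z - 2 = m%:Z by lia.
  by rewrite /= addrC.
- have -> : Negz m - 1 = Negz m.+1 by lia.
  have -> : Negz m - 2 = Negz m.+2 by lia.
  by rewrite /= subrKC.
Qed.

Lemma iter_fib_next_prev (m : nat) :
  [/\ iter m fib_prev (0, 1) =
        ((-1) ^+ m.+1 * fib m%:Z, (-1) ^+ m * (fib m.+1%:Z - fib m%:Z))
    & iter m fib_prev (2, 1) =
        ((-1) ^+ m * lucas m%:Z, (-1) ^+ m.+1 * (lucas m.+1%:Z - lucas m%:Z))].
Proof.
elim: m => [|m [IHf IHl]]; first by [].
rewrite !iterS IHf IHl /fib_prev /fib /lucas /= !exprS.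
by split; congr pair; ring.
Qed.

Lemma fibN (j : nat) : fib (- j%:Z) = (-1) ^+ j.+1 * fib j%:Z.
Proof.
case: j => [|m]; first by [].
by rewrite -NegzE /fib /fib_seq; have [-> _] := iter_fib_next_prev m.+1.
Qed.

Lemma lucasN (j : nat) : lucas (- j%:Z) = (-1) ^+ j * lucas j%:Z.
Proof.
case: j => [|m]; first by [].
by rewrite -NegzE /lucas /fib_seq; have [_ ->] := iter_fib_next_prev m.+1.
Qed.

(* Main.v *)
Require Import Defs.
From mathcomp Require Import all_boot all_order all_algebra.
From mathcomp Require Import algC ring zify.
Import GRing.Theory Num.Theory.
Local Open Scope ring_scope.

(** Expanding [((u - v) X + (u + v)) ((u - v) + (u + v) X) =
    u^2 (1 + X)^2 - v^2 (1 - X)^2] to the power [n] in two ways, the coefficient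
    of [X^n] gives
    [\sum_k C(n,k)^2 (u-v)^2k (u+v)^2(n-k) = \sum_k C(2k,k) C(2(n-k),n-k) u^2k v^2(n-k)],
    once the coefficient of [X^(k+m)] in [(1 + X)^2k (1 - X)^2m] is known to be
    [(-1)^m (2k)! (2m)! / (k! m! (k+m)!)] (von Szily). For [u, v] the roots
    [phi, psi] of [X^2 - X - 1] one has [u + v = 1], [(u - v)^2 = 5] and
    [u v = -1], so [phi^2k psi^2(n-k) = phi^(4k-2n)] and likewise with [phi] and
    [psi] exchanged; Binet's formula concludes. *)

Lemma coef_exp_linear (R : comNzRingType) (a b : R) (n i : nat) :
  ((a%:P + b *: 'X) ^+ n)`_i = a ^+ (n - i) * b ^+ i *+ 'C(n, i).
Proof.
rewrite exprDn coef_sum.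
under eq_bigr => j _.
  rewrite coefMn -polyC_exp exprZn coefCM coefZ coefXn; over.
case: (ltnP i n.+1) => [lt_in|lt_ni].
  rewrite (bigD1 (Ordinal lt_in)) //= eqxx mulr1 big1 ?addr0 // => j ne_ji.
  have -> : (i == j) = false by apply: contraNF ne_ji => /eqP e; apply/eqP/val_inj.
  by rewrite !mulr0 mul0rn.
rewrite bin_small // mulr0n big1 // => j _.
have -> : (i == j) = false by case: j => j /=; lia.
by rewrite !mulr0 mul0rn.
Qed.

(* The induction uses [(1 - X)^2 = (1 + X)^2 - 4 X]. *)
Lemma von_szily (F : numFieldType) (k m : nat) :
  ((1 + 'X) ^+ (2 * k) * (1 - 'X) ^+ (2 * m) : {poly F})`_(k + m)
    = (-1) ^+ m * ((2 * k)`!%:R * (2 * m)`!%:R)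
      / (k`!%:R * m`!%:R * (k + m)`!%:R).
Proof.
have fne0 j : j`!%:R != 0 :> F by rewrite pnatr_eq0 -lt0n fact_gt0.
have Sne0 j : 1 + j%:R != 0 :> F by rewrite -mulrS pnatr_eq0.
elim: m k => [|m IHm] k.
  rewrite muln0 expr0 mulr1 addn0 !fact0 !mul1r !mulr1.
  have := @coef_exp_linear F 1 1 (2 * k) k.
  rewrite scale1r !expr1n mulr1 => ->.
  have := @bin_fact (2 * k) k; rewrite mul2n -addnn addnK leq_addr => /(_ isT) <-.
  by rewrite !natrM mulfK // mulf_neq0.
have -> : (1 + 'X) ^+ (2 * k) * (1 - 'X) ^+ (2 * m.+1)
    = (1 + 'X) ^+ (2 * k.+1) * (1 - 'X) ^+ (2 * m)
      - 4%:R *: ((1 + 'X) ^+ (2 * k) * (1 - 'X) ^+ (2 * m) * 'X) :> {poly F}.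
  rewrite !mulnS !exprD scaler_nat; ring.
(* The hypothesis is used at two values of [k]: the index [k + m.+1] is [k.+1 + m] for the first
   product, and the factor ['X] lowers it to [k + m] in the second. *)
rewrite coefB coefZ coefMX addnS /= -addSn !IHm addSn.
rewrite !mulnS !add2n !factS !natrM !mulrS !natrM exprS natrD.
by field; rewrite !fne0 -natrD !Sne0.
Qed.

Lemma sum_central_binomials (F : numFieldType) (u v : F) (n : nat) :
  \sum_(k < n.+1) 'C(2 * k, k)%:R * 'C(2 * (n - k), n - k)%:R
      * (u ^+ (2 * k) * v ^+ (2 * (n - k)))
    = \sum_(k < n.+1) 'C(n, k)%:R ^+ 2
      * ((u - v) ^+ (2 * k) * (u + v) ^+ (2 * (n - k))).
Proof.
set w := u - v; set s := u + v.
have fne0 j : j`!%:R != 0 :> F by rewrite pnatr_eq0 -lt0n fact_gt0.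
have binE a b : (b <= a)%N -> 'C(a, b)%:R = a`!%:R / (b`!%:R * (a - b)`!%:R) :> F.
  by move=> le_ba; rewrite -(bin_fact le_ba) !natrM mulfK // mulf_neq0.
have factored : (s%:P + w *: 'X) ^+ n * (w%:P + s *: 'X) ^+ n
   = (- v ^+ 2 *: (1 - 'X) ^+ 2 + u ^+ 2 *: (1 + 'X) ^+ 2) ^+ n.
  rewrite -exprMn; congr (_ ^+ n).
  rewrite -!mul_polyC /s /w polyCN !polyCD !polyCN !polyC_exp; ring.
transitivity (\sum_(i < n.+1) ((- v ^+ 2 *: (1 - 'X) ^+ 2) ^+ (n - i)
    * (u ^+ 2 *: (1 + 'X) ^+ 2) ^+ i *+ 'C(n, i))`_n); last first.
  (* Cauchy product of the factored side: the second factor contributes ['C(n, n - j)], which equals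
     ['C(n, j)], whence the squares. *)
  rewrite -coef_sum -exprDn -factored coefM; apply: eq_bigr => -[j /= lt_jn] _.
  have le_jn : (j <= n)%N by [].
  rewrite !coef_exp_linear subKn // bin_sub // -[X in X * _]mulr_natr -[X in _ * X]mulr_natr.
  rewrite !mul2n -!addnn !exprD; ring.
apply: eq_bigr => -[j /= lt_jn] _.
have le_jn : (j <= n)%N by [].
rewrite !exprZn -scalerAl -scalerAr scalerA coefMn coefZ -!exprM mulrC.
set m := (n - j)%N; have -> : n = (j + m)%N by rewrite subnKC.
rewrite [(1 - 'X) ^+ _ * _]mulrC.
rewrite von_szily -[RHS]mulr_natr.
rewrite !binE ?leq_addr ?leq_pmull //.
rewrite addKn !mul2n -!addnn !addnK [(- v ^+ 2) ^+ _]exprNn -exprM mul2n -addnn.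
(* One sign comes from [- v ^+ 2], the other from [von_szily]. The factor [(j + m)!] of
   ['C(j + m, j)] cancels the one in the denominator there, leaving two central binomials. *)
have sgn : (-1) ^+ m * (-1) ^+ m = 1 :> F by rewrite -exprMn mulrNN mulr1 expr1n.
move: ((-1) ^+ m) sgn => e sgn.
by field: sgn; rewrite !fne0.
Qed.

(** The contribution of one root to Binet's formula. The hypotheses are symmetric in [u] and [v], so
    it serves for both roots. *)
Lemma sum_central_binomials_root (F : numFieldType) (u v : F) (r : int) (n : nat) :
    u + v = 1 -> u * v = -1 ->
  \sum_(k < n.+1) 'C(2 * k, k)%:R * 'C(2 * (n - k), n - k)%:R * u ^ (4 * k%:Z + r)
    = u ^ (2 * n%:Z + r) * \sum_(k < n.+1) 'C(n, k)%:R ^+ 2 * 5 ^+ k.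
Proof.
move=> uv_sum uv_prod.
have u_neq0 : u != 0.
  by apply/eqP => u0; move/eqP: uv_prod; rewrite u0 mul0r eq_sym oppr_eq0 oner_eq0.
have sqr_diff : (u - v) ^+ 2 = 5.
  have -> : (u - v) ^+ 2 = (u + v) ^+ 2 - 4 * (u * v) by ring.
  by rewrite uv_sum uv_prod; ring.
have := sum_central_binomials F u v n.
under [X in _ = X -> _]eq_bigr => k _.
  rewrite exprM sqr_diff uv_sum expr1n mulr1; over.
move <-; rewrite mulr_sumr; apply: eq_bigr => -[k /= lt_kn] _.
rewrite [RHS]mulrCA; congr (_ * _).
have le_kn : (k <= n)%N by [].
set m := (n - k)%N; have -> : n = (k + m)%N by rewrite subnKC.
(* The even exponent removes the sign of [u * v = -1]; [v ^+ (2 * m)] then cancels part of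
   [u ^ (2 * n + r)], leaving [u ^ (4 * k + r)]. *)
have uvm : u ^+ (2 * m) * v ^+ (2 * m) = 1.
  by rewrite -exprMn uv_prod exprM sqrrN !expr1n.
have -> : 4 * k%:Z + r = (2 * k)%:Z + (2 * k)%:Z + r by lia.
have -> : 2 * (k + m)%:Z + r = (2 * k)%:Z + (2 * m)%:Z + r by lia.
rewrite !(expfzDr _ _ u_neq0) -!exprnP.
move: (u ^+ (2 * m)) (v ^+ (2 * m)) uvm => p q pq.
ring: pq.
Qed.

Lemma fib_seq_binet (F : fieldType) (u v c d : F) (a b : int) :
    u + v = 1 -> u * v = -1 -> a%:~R = c + d -> b%:~R = c * u + d * v ->
  forall j : int, (fib_seq a b j)%:~R = c * u ^ j + d * v ^ j.
Proof.
move=> uv_sum uv_prod a_cd b_cd.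
have v_eq : v = 1 - u by rewrite -uv_sum addrC addKr.
have u_sqr : u * u = u + 1.
  by rewrite {2}(_ : u = 1 - v) ?mulrBr ?uv_prod ?mulr1 ?opprK // -uv_sum addrK.
have v_sqr : v * v = v + 1.
  by rewrite {2}v_eq mulrBr [v * u]mulrC uv_prod mulr1 opprK.
have next m : (iter m fib_next (a, b)).1%:~R = c * u ^+ m + d * v ^+ m
    /\ (iter m fib_next (a, b)).2%:~R = c * u ^+ m.+1 + d * v ^+ m.+1.
  elim: m => [|m [IH1 IH2]]; first by rewrite !expr0 !expr1 !mulr1.
  rewrite iterS /= rmorphD /= IH1 IH2; split=> //.
  by rewrite !exprS; ring: u_sqr v_sqr.
have u_inv : u^-1 = - v by apply: mulr1_eq; rewrite mulrN uv_prod opprK.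
have v_inv : v^-1 = - u by apply: mulr1_eq; rewrite mulrN mulrC uv_prod opprK.
(* Negative powers of [u] and [v] become natural powers of [- v] and [- u]; the second component
   stands for exponent [1 - m]. *)
have prev m : (iter m fib_prev (a, b)).1%:~R = c * (- v) ^+ m + d * (- u) ^+ m
    /\ (iter m fib_prev (a, b)).2%:~R = c * u * (- v) ^+ m + d * v * (- u) ^+ m.
  elim: m => [|m [IH1 IH2]]; first by rewrite !expr0 !mulr1.
  rewrite iterS /= rmorphB /= IH1 IH2 !exprS; split; last by ring: uv_prod.
  by move: ((- v) ^+ m) ((- u) ^+ m) => x y; rewrite v_eq; ring.
case=> m /=; first by case: (next m).
by case: (prev m.+1) => /= -> _; rewrite NegzE -!exprnN -!exprVn u_inv v_inv.
Qed.

(** Both sides are linear in the sequence, so the identity for powers of each root gives it for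
    arbitrary initial values. *)
Lemma fib_seq_sum (a b r : int) (n : nat) :
  \sum_(0 <= k < n.+1)
      'C(2 * k, k)%:Z * 'C(2 * (n - k), n - k)%:Z * fib_seq a b (4 * k%:Z + r)
    = fib_seq a b (2 * n%:Z + r) * \sum_(0 <= k < n.+1) 'C(n, k)%:Z ^+ 2 * 5 ^+ k.
Proof.
pose q : algC := sqrtC 5.
have q2 : q * q = 5 by rewrite -expr2 sqrtCK.
have q_neq0 : q != 0 by rewrite sqrtC_eq0 pnatr_eq0.
pose u := (1 + q) / 2; pose v := (1 - q) / 2.
have uv_sum : u + v = 1 by rewrite /u /v; field.
have uv_prod : u * v = -1.
  have -> : u * v = (1 - q * q) / 4 by rewrite /u /v; field.
  by rewrite q2; field.
have vu_sum : v + u = 1 by rewrite addrC.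
have vu_prod : v * u = -1 by rewrite mulrC.
(* Cramer's rule for [c + d = a], [c * u + d * v = b], where [u - v = q]. *)
pose c := (b%:~R - a%:~R * v) / q; pose d := (a%:~R * u - b%:~R) / q.
have a_cd : a%:~R = c + d by rewrite /c /d /u /v; field; rewrite q_neq0.
have b_cd : b%:~R = c * u + d * v by rewrite /c /d /u /v; field; rewrite q_neq0.
have binet := fib_seq_binet _ _ _ _ _ _ _ uv_sum uv_prod a_cd b_cd.
clearbody c d.
apply: (@intr_inj algC).
rewrite !big_mkord rmorphM !rmorph_sum /= binet mulrDl.
under [X in _ = _ * X + _]eq_bigr => k _ do rewrite rmorphM !rmorphXn /=.
under [X in _ = _ + _ * X]eq_bigr => k _ do rewrite rmorphM !rmorphXn /=.
rewrite -!mulrA -(sum_central_binomials_root _ _ _ r n uv_sum uv_prod).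
rewrite -(sum_central_binomials_root _ _ _ r n vu_sum vu_prod).
rewrite !mulr_sumr -big_split /=; apply: eq_bigr => k _.
by rewrite !rmorphM /= binet -!pmulrn; ring.
Qed.

Theorem theorem21 (r : int) (n : nat) :
  \sum_(0 <= k < n.+1)
      'C(2 * k, k)%:Z * 'C(2 * (n - k), n - k)%:Z * fib (4 * k%:Z + r)
    = fib (2 * n%:Z + r) * \sum_(0 <= k < n.+1) 'C(n, k)%:Z ^+ 2 * 5 ^+ k
  /\
  \sum_(0 <= k < n.+1)
      'C(2 * k, k)%:Z * 'C(2 * (n - k), n - k)%:Z * lucas (4 * k%:Z + r)
    = lucas (2 * n%:Z + r) * \sum_(0 <= k < n.+1) 'C(n, k)%:Z ^+ 2 * 5 ^+ k.
Proof. by split; apply: fib_seq_sum. Qed.
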